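(* The optimal value of problem (L) is invariant under invertible affine transformations. That is: let $X=\{x\in\mathbf{R}^n:Ax\le b\}$ be a polytope with $A\in\mathbf{R}^{m\times n}$, $b\in\mathbf{R}^m$, let $q(x)=x^TQx+2c^Tx$ with $Q$ a real symmetric $n\times n$ matrix and $c\in\mathbf{R}^n$, and let $T(y)=Hy+h$ with $H\in\mathbf{R}^{n\times n}$ invertible and $h\in\mathbf{R}^n$. Then the optimal value of problem (L) for the objective $q$ and the polytope $X=\{x:Ax\le b\}$ equals the optimal value of problem (L) for the objective $q\circ T$ and the polytope $T^{-1}(X)=\{y\in\mathbf{R}^n:AHy\le b-Ah\}$.
   Context: For a quadratic function $p$ (possibly with a constant term) and a polytope $Z=\{x\in\mathbf{R}^n:Gx\le g\}$ where $G\in\mathbf{R}^{m\times n}$ has rows $G_i$, problem (L) for the objective $p$ and the polytope $Z$ is $$\begin{array}{ll}\max & \ell\\ \text{s.t.} & p(x)-\ell+\sum_{i=1}^m\alpha_i(x)(G_ix-g_i)\in P[x],\\ & \alpha_i\in\mathcal{A}_+(Z),\ i=1,\dots,m,\end{array}$$ with variables $\ell\in\mathbf{R}$ and affine functions $\alpha_i$. $P[x]$ is the set of polynomials nonnegative on $\mathbf{R}^n$, and $\mathcal{A}_+(Z)$ is the set of affine functions nonnegative on $Z$. Polytopes are bounded and nonempty throughout. *)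

(* Defs.v *)
From HB Require Import structures.
From mathcomp Require Import all_boot all_order all_algebra.
From mathcomp Require Import all_classical all_reals all_analysis.
(* [mpoly] is not imported: its notations clash with those of MathComp-Analysis. *)
From mathcomp Require mpoly.

Set Implicit Arguments.
Unset Strict Implicit.
Unset Printing Implicit Defensive.

Import Order.TTheory GRing.Theory Num.Theory.
Import numFieldNormedType.Exports.

Local Open Scope classical_set_scope.
Local Open Scope ring_scope.

Definition polyhedron (R : realType) (m n : nat) (G : 'M[R]_(m, n))
    (g : 'cV[R]_m) : set 'cV[R]_n :=
  [set x | forall i, (G *m x) i 0 <= g i 0].

Definition is_polytope (R : realType) (n : nat) (Z : set 'cV[R]_n) : Prop :=
  [/\ exists (m : nat) (G : 'M[R]_(m, n)) (g : 'cV[R]_m), Z = polyhedron G g,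
      Z !=set0 & bounded_set Z].

Definition is_affine (R : realType) (n : nat) (f : 'cV[R]_n -> R) : Prop :=
  exists (a : 'cV[R]_n) (a0 : R), forall x, f x = (a^T *m x) 0 0 + a0.

Definition affine_nonneg (R : realType) (n : nat) (Z : set 'cV[R]_n)
    : set ('cV[R]_n -> R) :=
  [set f | is_affine f /\ forall x, Z x -> 0 <= f x].

(* Since R is infinite, a polynomial in n variables is identified with the
   function it induces on R^n. *)
Definition poly_nonneg (R : realType) (n : nat) : set ('cV[R]_n -> R) :=
  [set f : 'cV[R]_n -> R | (exists P : mpoly.mpoly n R,
              forall x : 'cV[R]_n, f x = mpoly.meval (fun i => x i 0) P)
           /\ forall x, 0 <= f x].

Definition L_feasible (R : realType) (m n : nat) (p : 'cV[R]_n -> R)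
    (G : 'M[R]_(m, n)) (g : 'cV[R]_m) (l : R)
    (alpha : 'I_m -> 'cV[R]_n -> R) : Prop :=
  poly_nonneg (fun x => p x - l + \sum_(i < m) alpha i x * ((G *m x) i 0 - g i 0))
  /\ forall i, affine_nonneg (polyhedron G g) (alpha i).

(* The optimal value is a supremum in the extended reals: it is -oo when no
   (l, alpha) is feasible, and attainment of the maximum is not presupposed. *)
Definition L_value (R : realType) (m n : nat) (p : 'cV[R]_n -> R)
    (G : 'M[R]_(m, n)) (g : 'cV[R]_m) : \bar R :=
  ereal_sup [set l%:E | l in [set l | exists alpha, L_feasible p G g l alpha]].

Definition quadratic (R : realType) (n : nat) (Q : 'M[R]_n) (c x : 'cV[R]_n) : R :=
  (x^T *m Q *m x) 0 0 + 2 * (c^T *m x) 0 0.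

Definition affine_map (R : realType) (n : nat) (H : 'M[R]_n) (h y : 'cV[R]_n)
    : 'cV[R]_n := H *m y + h.

(* Main.v *)
Require Import Defs.
From mathcomp Require Import all_boot all_order all_algebra.
From mathcomp Require Import all_classical all_reals all_analysis.
From mathcomp Require mpoly.
Import (canonicals) mpoly.

(* Substituting an affine map y |-> H y + h in a feasible pair (l, alpha) gives
   a feasible pair with the same l for the transformed data, whether or not H is
   invertible. Hence the optimal value does not decrease; applying this to the
   inverse affine map gives the other inequality. *)

Import Order.TTheory GRing.Theory Num.Theory.

Local Open Scope classical_set_scope.
Local Open Scope ring_scope.

Lemma norm_mx_entry_le (R : realType) (m n : nat) (M : 'M[R]_(m, n)) i j :
  `|M i j| <= `|M|.
Proof.
by rewrite [leRHS]/Num.norm /= mx_normrE; apply: (le_bigmax _ _ (i, j)).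
Qed.

(** The matrix norm is the maximum of the absolute values of the entries, and each entry of the
    product is a sum of [n] terms of size at most [|M| * |N|]; hence the factor [n]. *)
Lemma norm_mulmx_le (R : realType) (m n p : nat) (M : 'M[R]_(m, n))
    (N : 'M[R]_(n, p)) : `|M *m N| <= n%:R * (`|M| * `|N|).
Proof.
rewrite [leLHS]/Num.norm /= mx_normrE.
apply: bigmax_le => [|[i j] _ /=]; first by rewrite !mulr_ge0.
rewrite mxE (le_trans (ler_norm_sum _ _ _))//.
rewrite mulr_natl -[n in _ *+ n]card_ord -sumr_const ler_sum// => k _.
by rewrite normrM ler_pM// norm_mx_entry_le.
Qed.

Lemma affine_map_comp (R : realType) (n : nat) (H K : 'M[R]_n) (h k : 'cV[R]_n) :
  affine_map H h \o affine_map K k = affine_map (H *m K) (affine_map H h k).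
Proof.
by apply/funext => x; rewrite /affine_map /= mulmxDr mulmxA addrA.
Qed.

Lemma affine_map_invr (R : realType) (n : nat) (H : 'M[R]_n) (h : 'cV[R]_n) :
  H \in unitmx ->
  affine_map H h \o affine_map (invmx H) (- (invmx H *m h)) = id.
Proof.
move=> unitH; rewrite affine_map_comp; apply/funext => x.
by rewrite /affine_map mulmxV// mul1mx mulmxN mulKVmx// addNr addr0.
Qed.

Lemma bounded_preimage_affine_map (R : realType) (n : nat) (H : 'M[R]_n)
    (h : 'cV[R]_n) (Z : set 'cV[R]_n) :
  H \in unitmx -> bounded_set Z -> bounded_set (affine_map H h @^-1` Z).
Proof.
move=> unitH [B [_ ZB]].
(* The bound comes from [y = invmx H *m ((H *m y + h) - h)]. Boundedness of [Z] gives norm bounds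
   only by constants strictly above [B], hence [B + 1]. *)
exists (n%:R * (`|invmx H| * (B + 1 + `|h|))).
split=> [|C /ltW ltC y /= Zy]; first exact: num_real.
rewrite (le_trans _ ltC)//; have {1}-> : y = invmx H *m (affine_map H h y - h).
  by rewrite /affine_map addrK mulKmx.
apply: (le_trans (norm_mulmx_le _ _ _ _ _ _)).
rewrite !ler_wpM2l// (le_trans (ler_normB _ _))// lerD2r.
by apply: ZB Zy; rewrite ltrDl.
Qed.

(** This identity carries over both places where the constraints occur: the description of the
    polyhedron and the factors of the multipliers in problem (L). *)
Lemma constraint_affine_map (R : realType) (m n : nat) (G : 'M[R]_(m, n))
    (g : 'cV[R]_m) (H : 'M[R]_n) (h y : 'cV[R]_n) i :
  (G *m H *m y) i 0 - (g - G *m h) i 0 = (G *m affine_map H h y) i 0 - g i 0.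
Proof.
by rewrite /affine_map mulmxDr mulmxA !mxE opprB addrA addrAC.
Qed.

Lemma preimage_polyhedron (R : realType) (m n : nat) (G : 'M[R]_(m, n))
    (g : 'cV[R]_m) (H : 'M[R]_n) (h : 'cV[R]_n) :
  affine_map H h @^-1` polyhedron G g = polyhedron (G *m H) (g - G *m h).
Proof.
apply/seteqP; split=> y /= Gy i; have := Gy i.
  by rewrite -subr_le0 -constraint_affine_map subr_le0.
by rewrite -subr_le0 constraint_affine_map subr_le0.
Qed.

Lemma is_polytope_preimage (R : realType) (m n : nat) (G : 'M[R]_(m, n))
    (g : 'cV[R]_m) (H : 'M[R]_n) (h : 'cV[R]_n) :
  H \in unitmx -> is_polytope (polyhedron G g) ->
  is_polytope (polyhedron (G *m H) (g - G *m h)).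
Proof.
move=> unitH [_ [x Gx] bndG]; split; first by exists m, (G *m H), (g - G *m h).
(* Nonemptiness: the inverse affine map sends a point of the original polytope into the preimage. *)
- exists (affine_map (invmx H) (- (invmx H *m h)) x).
  rewrite -preimage_polyhedron /preimage /=.
  by have /(congr1 (@^~ x)) /= -> := affine_map_invr _ _ _ h unitH.
- by rewrite -preimage_polyhedron; exact: bounded_preimage_affine_map.
Qed.

Lemma is_affine_comp (R : realType) (n : nat) (f : 'cV[R]_n -> R) (H : 'M[R]_n)
    (h : 'cV[R]_n) : is_affine f -> is_affine (f \o affine_map H h).
Proof.
move=> [a [a0 fE]]; exists (H^T *m a), ((a^T *m h) 0 0 + a0) => y.
by rewrite /= fE /affine_map trmx_mul trmxK mulmxDr mulmxA mxE addrA.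
Qed.

(** Nonnegativity everywhere passes to any composite; the composite is again polynomial because the
    coordinates of the affine map can be substituted for the variables. *)
Lemma poly_nonneg_comp (R : realType) (n : nat) (f : 'cV[R]_n -> R)
    (H : 'M[R]_n) (h : 'cV[R]_n) :
  poly_nonneg f -> poly_nonneg (f \o affine_map H h).
Proof.
move=> [[P fE] f_ge0]; split=> [|y]; last exact: f_ge0.
(* [T i] is the [i]-th coordinate of [H *m y + h] as a polynomial of degree at most one in the
   coordinates of [y]. *)
pose T (i : 'I_n) : mpoly.mpoly n R :=
  \sum_(j < n) H i j *: mpoly.mpolyX R (mpoly.mnm1 j) + mpoly.mpolyC n (h i 0).
exists (mpoly.comp_mpoly [tuple T i | i < n] P) => y.
rewrite /= fE mpoly.comp_mpoly_meval; congr (mpoly.meval _ P).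
apply/funext => i; rewrite tnth_mktuple mpoly.mevalD mpoly.mevalC.
rewrite (raddf_sum (mpoly.meval _)) !mxE; congr (_ + _); apply: eq_bigr => j _.
by rewrite [RHS]mpoly.mevalZ mpoly.mevalXU.
Qed.

Lemma L_feasible_comp (R : realType) (m n : nat) (p : 'cV[R]_n -> R)
    (G : 'M[R]_(m, n)) (g : 'cV[R]_m) (H : 'M[R]_n) (h : 'cV[R]_n) (l : R)
    (alpha : 'I_m -> 'cV[R]_n -> R) :
  L_feasible p G g l alpha ->
  L_feasible (p \o affine_map H h) (G *m H) (g - G *m h) l
    (fun i => alpha i \o affine_map H h).
Proof.
move=> [pP alphaP]; split=> [|i].
  (* The polynomial required for the new data is the old one composed with the affine map; the two
     sums agree term by term. *)
  have := poly_nonneg_comp _ _ _ H h pP; congr (poly_nonneg _).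
  apply/funext => y /=; congr (_ + _); apply: eq_bigr => i _.
  by rewrite constraint_affine_map.
have [alphaA alpha_ge0] := alphaP i; split; first exact: is_affine_comp.
by move=> y; rewrite -preimage_polyhedron => /alpha_ge0.
Qed.

Lemma L_value_comp_le (R : realType) (m n : nat) (p : 'cV[R]_n -> R)
    (G : 'M[R]_(m, n)) (g : 'cV[R]_m) (H : 'M[R]_n) (h : 'cV[R]_n) :
  (L_value p G g <= L_value (p \o affine_map H h) (G *m H) (g - G *m h))%E.
Proof.
apply: ereal_sup_le => _ [l [alpha feas] <-]; exists l => //.
by exists (fun i => alpha i \o affine_map H h); exact: L_feasible_comp.
Qed.

Lemma L_value_comp (R : realType) (m n : nat) (p : 'cV[R]_n -> R)
    (G : 'M[R]_(m, n)) (g : 'cV[R]_m) (H : 'M[R]_n) (h : 'cV[R]_n) :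
  H \in unitmx ->
  L_value p G g = L_value (p \o affine_map H h) (G *m H) (g - G *m h).
Proof.
move=> unitH; apply/le_anti/andP; split; first exact: L_value_comp_le.
(* Transforming the new data by the inverse map restores the old data: the objective by
   [affine_map_invr], the matrix by [G *m H *m invmx H = G], and the right-hand side because
   [G *m H *m (invmx H *m h) = G *m h] is added back to [g - G *m h]. *)
apply: (le_trans (L_value_comp_le _ _ _ _ _ _ (invmx H) (- (invmx H *m h)))).
rewrite -compA affine_map_invr// mulmxK// mulmxN mulmxA mulmxK// opprK subrK.
exact: lexx.
Qed.

Theorem proposition5 (R : realType) (m n : nat) (A : 'M[R]_(m, n)) (b : 'cV[R]_m)
    (Q : 'M[R]_n) (c : 'cV[R]_n) (H : 'M[R]_n) (h : 'cV[R]_n)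
    (polytopeX : is_polytope (polyhedron A b))
    (symQ : Q^T = Q)
    (unitH : H \in unitmx) :
  [/\ affine_map H h @^-1` polyhedron A b = polyhedron (A *m H) (b - A *m h),
      is_polytope (polyhedron (A *m H) (b - A *m h)) &
      L_value (quadratic Q c) A b =
      L_value (quadratic Q c \o affine_map H h) (A *m H) (b - A *m h)].
Proof.
split; first exact: preimage_polyhedron.
- exact: is_polytope_preimage.
- exact: L_value_comp.
Qed.
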